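(* Let $\alpha,\beta\in\mathbb{R}$. If $\alpha\ge\beta\ge\frac12$, then $$I(x,y)<\biggl[\biggl(\frac{x}{y}\biggr)^{\alpha-\beta}\frac{\Gamma(x+\beta)}{\Gamma(y+\beta)}\biggr]^{1/(x-y)}$$ holds for all $x,y\in(0,\infty)$ with $x\ne y$, where $$I(a,b)=\frac1e\biggl(\frac{b^b}{a^a}\biggr)^{1/(b-a)}$$ for $a>0$ and $b>0$ with $a\ne b$ is the identric (exponential) mean.
   Context: $\Gamma$ denotes the classical Euler gamma function, $\Gamma(x)=\int_0^\infty t^{x-1}e^{-t}\,dt$ for $x>0$. *)

(* Defs.v *)
From Stdlib Require Import Reals.
From Coquelicot Require Import Coquelicot.
Open Scope R_scope.

(* The integral is improper at both ends: at_right 0 keeps the lower bound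
   positive, where Rpower t (x - 1) is the genuine power.  It converges exactly
   for 0 < x, and the value is meaningful only for such x. *)
Definition Gamma (x : R) : R :=
  RInt_gen (fun t : R => Rpower t (x - 1) * exp (- t))
           (at_right 0) (Rbar_locally p_infty).

(* Meaningful only for 0 < a, 0 < b and a <> b; exp 1 is Euler's number. *)
Definition identric_mean (a b : R) : R :=
  1 / exp 1 * Rpower (Rpower b b / Rpower a a) (1 / (b - a)).

(* Main.v *)
Require Import Defs.
From Stdlib Require Import Reals Lra.
From Coquelicot Require Import Coquelicot.
Open Scope R_scope.

(** Taking logarithms, the claim says that
    [(alpha - beta) * ln u + F u], with [F u = ln (Gamma (u + beta)) - u * ln u + u],
    is strictly increasing on the positive reals; the first summand is nondecreasing, so it
    suffices to treat [F].  No derivative of Gamma is needed: by [Gamma (z + 1) = z * Gamma z],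
    [F (u + 1) - F u] is elementary, and it is strictly decreasing because
    [ln (1 + 1 / u) > 1 / (u + 1 / 2)].  Hence for [y < x] the differences
    [F (x + n) - F (y + n)] strictly decrease in [n], and they are bounded below by a
    quantity tending to 0 since [Gamma (z + s) >= (z - 1) ^ s * Gamma z]. *)

(** * Improper integrals of nonnegative functions over the positive half-line *)

Lemma filter_prod_pos_ordered (P : R * R -> Prop) :
  (forall a b, 0 < a <= b -> P (a, b)) ->
  filter_prod (at_right 0) (Rbar_locally p_infty) P.
Proof.
  intros H.
  apply (Filter_prod _ _ _ (fun a => 0 < a < 1) (fun b => 1 < b)).
  - exists (mkposreal 1 Rlt_0_1). intros y Hy Hy0.
    unfold ball in Hy; simpl in Hy; unfold AbsRing_ball, abs, minus, plus, opp in Hy; simpl in Hy.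
    apply Rabs_lt_between in Hy. lra.
  - exists 1. auto.
  - intros a b Ha Hb. apply H. lra.
Qed.

(** The limit is the supremum of the proper integrals: once some [[a0, b0]] comes within [eps] of
    it, nonnegativity keeps every larger interval as close. *)
Lemma is_RInt_gen_nonneg_bounded (f : R -> R) (M : R) :
  (forall t, 0 < t -> continuous f t) ->
  (forall t, 0 < t -> 0 <= f t) ->
  (forall a b, 0 < a <= b -> RInt f a b <= M) ->
  exists l, is_RInt_gen f (at_right 0) (Rbar_locally p_infty) l /\
    forall a b, 0 < a <= b -> RInt f a b <= l.
Proof.
  intros Hc Hp HM.
  assert (Hex : forall a b, 0 < a -> 0 < b -> ex_RInt f a b).
  { intros a b Ha Hb. apply (ex_RInt_continuous (V := R_CompleteNormedModule)). intros t Ht. apply Hc.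
    apply Rlt_le_trans with (Rmin a b); [now apply Rmin_glb_lt | tauto]. }
  destruct (completeness (fun v => exists a b, 0 < a <= b /\ v = RInt f a b))
    as [l [Hub Hlub]].
  { exists M. intros v (a & b & Hab & ->). now apply HM. }
  { exists (RInt f 1 1), 1, 1. split; [lra | reflexivity]. }
  assert (Hl : forall a b, 0 < a <= b -> RInt f a b <= l).
  { intros a b Hab. apply Hub. now exists a, b. }
  exists l; split; [|exact Hl].
  apply filterlimi_locally.
  intros eps.
  assert (Hclose : exists a0 b0, 0 < a0 <= b0 /\ l - eps < RInt f a0 b0).
  { apply Classical_Prop.NNPP. intros Hn.
    assert (l <= l - eps).
    { apply Hlub. intros v (a & b & Hab & ->).
      destruct (Rle_or_lt (RInt f a b) (l - eps)) as [H|H]; [exact H|].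
      exfalso. apply Hn. now exists a, b. }
    pose proof (cond_pos eps). lra. }
  destruct Hclose as (a0 & b0 & H0 & Hlt).
  apply (Filter_prod _ _ _ (fun a => 0 < a < a0) (fun b => b0 < b)).
  - assert (Ha0 : 0 < a0) by lra. exists (mkposreal a0 Ha0). intros y Hy Hy0.
    unfold ball in Hy; simpl in Hy; unfold AbsRing_ball, abs, minus, plus, opp in Hy; simpl in Hy.
    apply Rabs_lt_between in Hy. lra.
  - exists b0. auto.
  - intros a b Ha Hb. simpl. exists (RInt f a b). split.
    { apply (@RInt_correct R_CompleteNormedModule). apply Hex; lra. }
    assert (E1 : RInt f a a0 + RInt f a0 b = RInt f a b)
      by (apply (@RInt_Chasles R_CompleteNormedModule); apply Hex; lra).
    assert (E2 : RInt f a0 b0 + RInt f b0 b = RInt f a0 b)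
      by (apply (@RInt_Chasles R_CompleteNormedModule); apply Hex; lra).
    assert (0 <= RInt f a a0)
      by (apply RInt_ge_0; [lra | apply Hex; lra | intros; apply Hp; lra]).
    assert (0 <= RInt f b0 b)
      by (apply RInt_ge_0; [lra | apply Hex; lra | intros; apply Hp; lra]).
    assert (RInt f a b <= l) by (apply Hl; lra).
    unfold ball; simpl; unfold AbsRing_ball, abs, minus, plus, opp; simpl.
    pose proof (cond_pos eps).
    apply Rabs_lt_between. lra.
Qed.

Lemma is_RInt_gen_ge_0 (f : R -> R) (l : R) :
  (forall t, 0 < t -> 0 <= f t) ->
  is_RInt_gen f (at_right 0) (Rbar_locally p_infty) l -> 0 <= l.
Proof.
  intros Hf Hl.
  apply Rle_trans with (norm l); [apply norm_ge_0|].
  (* [f] serves as its own majorant, so the norm bound reads [norm l <= l]. *)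
  apply (@RInt_gen_norm R_CompleteNormedModule (at_right 0) (Rbar_locally p_infty)
           _ _ f f l l); try assumption.
  - apply filter_prod_pos_ordered. simpl. intros a b H; lra.
  - apply filter_prod_pos_ordered. simpl. intros a b H t Ht.
    unfold norm; simpl; unfold abs; simpl.
    rewrite Rabs_pos_eq; [lra | apply Hf; lra].
Qed.

(** * The Gamma integral: convergence and positivity *)

Definition gamma_integrand (z t : R) : R := Rpower t (z - 1) * exp (- t).

Lemma gamma_integrand_pos (z t : R) : 0 < gamma_integrand z t.
Proof. apply Rmult_lt_0_compat; apply exp_pos. Qed.

Lemma gamma_integrand_continuous (z t : R) :
  0 < t -> continuous (gamma_integrand z) t.
Proof.
  intros Ht. apply (@ex_derive_continuous R_AbsRing R_NormedModule).
  unfold gamma_integrand, Rpower. auto_derive. lra.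
Qed.

Lemma gamma_integrand_succ (z t : R) :
  0 < t -> gamma_integrand (z + 1) t = t * gamma_integrand z t.
Proof.
  intros Ht. unfold gamma_integrand.
  replace (z + 1 - 1) with (z - 1 + 1) by ring.
  rewrite Rpower_plus, Rpower_1 by assumption. ring.
Qed.

Lemma exp_le_exp (u v : R) : u <= v -> exp u <= exp v.
Proof.
  intros [H| ->]; [now apply Rlt_le, exp_increasing | apply Rle_refl].
Qed.

Lemma ln_le_sub_1 (u : R) : 0 < u -> ln u <= u - 1.
Proof.
  intros Hu. pose proof (exp_ineq1_le (ln u)) as H. rewrite exp_ln in H; lra.
Qed.

(** The tangent to [ln] at [p] lies above the graph. The free choice of [p] lets a linear term
    absorb any multiple of [ln]. *)
Lemma mul_ln_le (p u : R) : 0 < p -> 0 < u -> p * ln u <= u - p + p * ln p.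
Proof.
  intros Hp Hu.
  pose proof (ln_le_sub_1 (u / p) (Rdiv_lt_0_compat _ _ Hu Hp)) as H.
  rewrite ln_div in H by assumption.
  apply (Rmult_le_compat_l p) in H; [|lra].
  replace (p * (u / p - 1)) with (u - p) in H by (field; lra). lra.
Qed.

(* The dominating function is [C] times the derivative of [(t / (1 + t)) ^ z / z]. *)
Lemma RInt_gamma_integrand_le (z a b : R) :
  0 < z -> 0 < a <= b ->
  RInt (gamma_integrand z) a b <= exp (1 - (z + 1) + (z + 1) * ln (z + 1)) / z.
Proof.
  intros Hz Hab.
  set (C := exp _).
  set (G := fun t => C / z * exp (z * (ln t - ln (1 + t)))).
  set (g := fun t => C * exp ((z - 1) * ln t - (z + 1) * ln (1 + t))).
  assert (HC : 0 < C) by apply exp_pos.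
  assert (Hg : is_RInt g a b (minus (G b) (G a))).
  { apply (@is_RInt_derive R_CompleteNormedModule).
    - rewrite Rmin_left, Rmax_right by lra. intros t Ht.
      assert (E : g t = C / z * (z * (/ t - / (1 + t)) * exp (z * (ln t - ln (1 + t))))).
      { unfold g.
        replace ((z - 1) * ln t - (z + 1) * ln (1 + t))
          with (z * (ln t - ln (1 + t)) + (- ln t + - ln (1 + t))) by ring.
        rewrite !exp_plus, !exp_Ropp, !exp_ln by lra. field. lra. }
      rewrite E. unfold G. auto_derive; [lra|]. unfold Rminus. ring.
    - rewrite Rmin_left, Rmax_right by lra. intros t Ht.
      apply (@ex_derive_continuous R_AbsRing R_NormedModule).
      unfold g. auto_derive. lra. }
  apply Rle_trans with (RInt g a b).
  - apply RInt_le; [lra | | now exists (minus (G b) (G a)) |].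
    + apply (ex_RInt_continuous (V := R_CompleteNormedModule)).
      rewrite Rmin_left, Rmax_right by lra. intros t Ht.
      apply gamma_integrand_continuous. lra.
    + intros t Ht. unfold gamma_integrand, Rpower, g, C. rewrite <- !exp_plus.
      apply exp_le_exp.
      (* The tangent at [z + 1] bounds [exp (- t)] by [C * (1 + t) ^ (- (z + 1))]. *)
      pose proof (mul_ln_le (z + 1) (1 + t)). lra.
  - rewrite (is_RInt_unique _ _ _ _ Hg).
    assert (HCz : 0 < C / z) by now apply Rdiv_lt_0_compat.
    assert (0 < G a) by (apply Rmult_lt_0_compat; [exact HCz | apply exp_pos]).
    assert (G b <= C / z * 1).
    { apply Rmult_le_compat_l; [lra|]. apply (Rle_trans _ (exp 0)); [|rewrite exp_0; lra].
      apply exp_le_exp.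
      assert (ln b < ln (1 + b)) by (apply ln_increasing; lra).
      assert (0 < z * (ln (1 + b) - ln b)) by (apply Rmult_lt_0_compat; lra). lra. }
    unfold minus, plus, opp; simpl. lra.
Qed.

(** [RInt_gen] merely selects a value, so convergence has to be shown before [Gamma z] can be used;
    the bound by proper integrals then yields positivity. *)
Lemma Gamma_spec (z : R) :
  0 < z ->
  is_RInt_gen (gamma_integrand z) (at_right 0) (Rbar_locally p_infty) (Gamma z) /\
  forall a b, 0 < a <= b -> RInt (gamma_integrand z) a b <= Gamma z.
Proof.
  intros Hz.
  destruct (is_RInt_gen_nonneg_bounded (gamma_integrand z)
              (exp (1 - (z + 1) + (z + 1) * ln (z + 1)) / z)) as (l & Hl & Hle).
  - intros t Ht. now apply gamma_integrand_continuous.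
  - intros t _. apply Rlt_le, gamma_integrand_pos.
  - intros a b Hab. now apply RInt_gamma_integrand_le.
  - assert (E : Gamma z = l) by exact (is_RInt_gen_unique _ _ Hl).
    rewrite E. now split.
Qed.

Lemma Gamma_pos (z : R) : 0 < z -> 0 < Gamma z.
Proof.
  intros Hz. apply Rlt_le_trans with (RInt (gamma_integrand z) 1 2).
  - apply RInt_gt_0; [lra | |].
    + intros t _. apply gamma_integrand_pos.
    + intros t Ht. apply gamma_integrand_continuous. lra.
  - apply Gamma_spec; lra.
Qed.

(** * The functional equation of Gamma and a lower bound for its shifts *)

Lemma gamma_boundary_0 (z : R) :
  0 < z -> filterlim (fun t => exp (z * ln t - t)) (at_right 0) (locally 0).
Proof.
  intros Hz.
  apply (filterlim_comp _ _ _ (fun t => z * ln t - t) exp _ (Rbar_locally m_infty));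
    [|exact is_lim_exp_m].
  intros P [M HM].
  assert (H : Rbar_locally m_infty (fun u => u < M / z)) by (exists (M / z); auto).
  destruct (is_lim_ln_0 _ H) as [eps Heps].
  exists eps. intros t Ht Ht0. apply HM.
  specialize (Heps t Ht Ht0).
  apply (Rmult_lt_compat_l z) in Heps; [|exact Hz].
  replace (z * (M / z)) with M in Heps by (field; lra). lra.
Qed.

Lemma gamma_boundary_infty (z : R) :
  0 < z -> filterlim (fun t => exp (z * ln t - t)) (Rbar_locally p_infty) (locally 0).
Proof.
  intros Hz.
  apply (filterlim_comp _ _ _ (fun t => z * ln t - t) exp _ (Rbar_locally m_infty));
    [|exact is_lim_exp_m].
  intros P [M HM].
  (* The tangent at [2 * z] gives [z * ln t - t <= - t / 2 - z + z * ln (2 * z)] for [t > 0], which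
     is below [M] past this threshold. *)
  exists (Rmax 0 (2 * (z * ln (2 * z) - z - M))). intros t Ht. apply HM.
  apply Rmax_Rlt in Ht.
  pose proof (mul_ln_le (2 * z) t). lra.
Qed.

(** Integration by parts: [h], that is [t ^ z * exp (- t)], tends to 0 at both ends, so its
    derivative [z * gamma_integrand z t - gamma_integrand (z + 1) t] has integral zero. *)
Lemma Gamma_succ (z : R) : 0 < z -> Gamma (z + 1) = z * Gamma z.
Proof.
  intros Hz.
  set (h := fun t => exp (z * ln t - t)).
  assert (Hd : forall t, 0 < t ->
    is_derive h t (z * gamma_integrand z t - gamma_integrand (z + 1) t)).
  { intros t Ht. rewrite gamma_integrand_succ by assumption.
    assert (E : z * gamma_integrand z t - t * gamma_integrand z t
                = (z * / t - 1) * exp (z * ln t - t)).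
    { unfold gamma_integrand, Rpower.
      replace (z * ln t - t) with ((z - 1) * ln t + ln t + - t) by ring.
      rewrite !exp_plus, exp_ln by assumption. field. lra. }
    rewrite E. unfold h. auto_derive; [assumption|]. unfold Rminus. ring. }
  assert (H1 : is_RInt_gen (Derive h) (at_right 0) (Rbar_locally p_infty) (0 - 0)).
  { apply is_RInt_gen_Derive.
    - apply filter_prod_pos_ordered. simpl. intros a b Hab.
      rewrite Rmin_left by lra. intros t Ht. eexists. apply Hd. lra.
    - apply filter_prod_pos_ordered. simpl. intros a b Hab.
      rewrite Rmin_left by lra. intros t Ht.
      apply (continuous_ext_loc _
        (fun t => z * gamma_integrand z t - gamma_integrand (z + 1) t)).
      + assert (Ht0 : 0 < t) by lra. exists (mkposreal t Ht0). intros u Hu.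
        symmetry. apply is_derive_unique, Hd.
        unfold ball in Hu; simpl in Hu; unfold AbsRing_ball, abs, minus, plus, opp in Hu; simpl in Hu.
        apply Rabs_lt_between in Hu. lra.
      + apply (@continuous_minus R_UniformSpace R_AbsRing R_NormedModule).
        * apply (@continuous_scal_r R_UniformSpace R_AbsRing R_NormedModule).
          apply gamma_integrand_continuous. lra.
        * apply gamma_integrand_continuous. lra.
    - now apply gamma_boundary_0.
    - now apply gamma_boundary_infty. }
  destruct (Gamma_spec z) as [H2 _]; [assumption|].
  destruct (Gamma_spec (z + 1)) as [H3 _]; [lra|].
  pose proof (is_RInt_gen_minus _ _ _ _ (is_RInt_gen_scal _ z _ H2) H3) as H4.
  assert (H5 : is_RInt_gen (Derive h) (at_right 0) (Rbar_locally p_infty)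
                 (minus (scal z (Gamma z)) (Gamma (z + 1)))).
  { refine (is_RInt_gen_ext _ _ _ _ H4).
    apply filter_prod_pos_ordered. simpl. intros a b Hab.
    rewrite Rmin_left by lra. intros t Ht.
    symmetry. apply is_derive_unique, Hd. lra. }
  pose proof (is_RInt_gen_unique _ _ H1) as E1.
  pose proof (is_RInt_gen_unique _ _ H5) as E5.
  rewrite E1 in E5. unfold minus, scal, plus, opp in E5; simpl in E5.
  unfold mult in E5; simpl in E5. lra.
Qed.

(* Integrate [t ^ s >= c ^ s * (1 + s * (1 - c / t))], with [c = z - 1],
   against the Gamma density: the last term integrates to zero. *)
Lemma Gamma_shift_ge (z s : R) :
  1 < z -> 0 < s -> Rpower (z - 1) s * Gamma z <= Gamma (z + s).
Proof.
  intros Hz Hs.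
  set (c := z - 1). assert (Hc : 0 < c) by (unfold c; lra).
  set (K := Rpower c s).
  destruct (Gamma_spec (z + s)) as [H1 _]; [lra|].
  destruct (Gamma_spec z) as [H2 _]; [lra|].
  destruct (Gamma_spec c) as [H3 _]; [lra|].
  pose proof (is_RInt_gen_plus _ _ _ _
    (is_RInt_gen_minus _ _ _ _ H1 (is_RInt_gen_scal _ (K * (1 + s)) _ H2))
    (is_RInt_gen_scal _ (K * s * c) _ H3)) as H.
  apply is_RInt_gen_ge_0 in H.
  - unfold plus, minus, scal, plus, opp in H; simpl in H. unfold mult in H; simpl in H.
    assert (E : Gamma z = c * Gamma c)
      by (rewrite <- Gamma_succ by assumption; f_equal; unfold c; ring).
    rewrite E in H |- *. lra.
  - intros t Ht. unfold plus, minus, scal, plus, opp; simpl. unfold mult; simpl.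
    replace (gamma_integrand z t) with (t * gamma_integrand c t)
      by (rewrite <- gamma_integrand_succ by assumption; f_equal; unfold c; ring).
    assert (E : gamma_integrand (z + s) t
                = K * exp (s * (ln t - ln c)) * t * gamma_integrand c t).
    { rewrite Rmult_assoc, <- gamma_integrand_succ by assumption.
      unfold gamma_integrand, K, Rpower. rewrite <- exp_plus, <- Rmult_assoc, <- !exp_plus.
      f_equal. unfold c. ring. }
    rewrite E.
    assert (HK : 0 < K) by apply exp_pos.
    assert (Hl : ln c - ln t <= c / t - 1)
      by (rewrite <- ln_div by assumption; now apply ln_le_sub_1, Rdiv_lt_0_compat).
    (* Together with [Hl] this is the bound [(t / c) ^ s >= 1 + s * (1 - c / t)]. *)
    pose proof (exp_ineq1_le (s * (ln t - ln c))) as He.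
    assert (0 <= s * (c / t - 1 - (ln c - ln t))) by (apply Rmult_le_pos; lra).
    assert (Hm : 0 <= exp (s * (ln t - ln c)) - (1 + s * (1 - c / t))) by lra.
    pose proof (gamma_integrand_pos c t) as Hg.
    assert (Hw : 0 <= K * t * gamma_integrand c t).
    { apply Rlt_le, Rmult_lt_0_compat; [now apply Rmult_lt_0_compat | exact Hg]. }
    pose proof (Rmult_le_pos _ _ Hw Hm) as Hf.
    replace (K * t * gamma_integrand c t * (exp (s * (ln t - ln c)) - (1 + s * (1 - c / t))))
      with (K * exp (s * (ln t - ln c)) * t * gamma_integrand c t
            + - (K * (1 + s) * (t * gamma_integrand c t)) + K * s * c * gamma_integrand c t)
      in Hf by (field; lra).
    exact Hf.
Qed.

(** * Sharp lower bounds for logarithms of ratios *)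

(** The difference of the two sides vanishes at 0 and has derivative [2 * v² / (1 - v²)], positive
    inside the interval. *)
Lemma ln_ratio_gt (w : R) : 0 < w < 1 -> 2 * w < ln (1 + w) - ln (1 - w).
Proof.
  intros Hw.
  destruct (MVT_cor2 (fun v => ln (1 + v) - ln (1 - v) - 2 * v)
              (fun v => 2 * v² / (1 - v²)) 0 w) as (c & E & Hc); [lra | |].
  - intros v Hv. apply is_derive_Reals. auto_derive; [lra|].
    unfold Rsqr. field. nra.
  - rewrite Rplus_0_r, Rminus_0_r, ln_1 in E.
    assert (0 < 2 * c² / (1 - c²)).
    { apply Rdiv_lt_0_compat; unfold Rsqr; nra. }
    nra.
Qed.

(** Substitute [w = / (2 * u + 1)]: then [(1 + w) / (1 - w) = (u + 1) / u] and
    [2 * w = / (u + 1 / 2)]. This is the origin of the threshold [1 / 2] for [beta]. *)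
Lemma ln_succ_sub_ln_gt (u : R) : 0 < u -> / (u + 1 / 2) < ln (u + 1) - ln u.
Proof.
  intros Hu.
  assert (Hw : 0 < / (2 * u + 1) < 1).
  { split; [apply Rinv_0_lt_compat; lra|].
    rewrite <- Rinv_1. apply Rinv_lt_contravar; lra. }
  pose proof (ln_ratio_gt _ Hw) as H.
  rewrite <- ln_div in H by lra. rewrite <- ln_div by lra.
  replace ((1 + / (2 * u + 1)) / (1 - / (2 * u + 1))) with ((u + 1) / u) in H
    by (field; lra).
  replace (/ (u + 1 / 2)) with (2 * / (2 * u + 1)) by (field; lra).
  exact H.
Qed.

(** * Strict monotonicity of [log_gamma_gap] *)

(** The elementary terms are chosen so that, for distinct positive [x] and [y], they contribute
    [- (x - y) * ln (identric_mean x y)] to the difference of the values at [x] and [y]. *)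
Definition log_gamma_gap (beta x : R) : R := ln (Gamma (x + beta)) - x * ln x + x.

Lemma log_gamma_gap_succ (beta x : R) :
  0 < beta -> 0 < x ->
  log_gamma_gap beta (x + 1) =
  log_gamma_gap beta x + (ln (x + beta) - (x + 1) * ln (x + 1) + x * ln x + 1).
Proof.
  intros Hb Hx. unfold log_gamma_gap.
  replace (x + 1 + beta) with (x + beta + 1) by ring.
  rewrite Gamma_succ, ln_mult by (try apply Gamma_pos; lra). ring.
Qed.

(** The increment over a unit step has derivative [/ (u + beta) - ln (u + 1) + ln u], which is
    negative when [beta >= 1 / 2]. *)
Lemma log_gamma_gap_diff_succ (beta x y : R) :
  1 / 2 <= beta -> 0 < y < x ->
  log_gamma_gap beta (x + 1) - log_gamma_gap beta (y + 1) <
  log_gamma_gap beta x - log_gamma_gap beta y.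
Proof.
  intros Hb Hxy. rewrite !log_gamma_gap_succ by lra.
  destruct (MVT_cor2 (fun u => ln (u + beta) - (u + 1) * ln (u + 1) + u * ln u)
              (fun u => / (u + beta) - ln (u + 1) + ln u) y x) as (c & E & Hc); [lra | |].
  - intros v Hv. apply is_derive_Reals. auto_derive; [lra|]. field. lra.
  - assert (H := ln_succ_sub_ln_gt c).
    assert (/ (c + beta) <= / (c + 1 / 2)) by (apply Rinv_le_contravar; lra).
    nra.
Qed.

(** With [c = y + beta - 1], the Gamma terms contribute at least [(x - y) * ln c], and the
    elementary terms exactly [- (x - y) * ln d] for some [d] between [y] and [x]. When [x] and [y]
    move by the same amount, only the denominator of the bound changes. *)
Lemma log_gamma_gap_diff_ge (beta x y : R) :
  0 < beta -> 1 < y + beta -> 0 < y < x ->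
  - ((x - y) * (x - (y + beta - 1)) / (y + beta - 1)) <=
  log_gamma_gap beta x - log_gamma_gap beta y.
Proof.
  intros Hb Hyb Hxy. unfold log_gamma_gap.
  set (c := y + beta - 1). assert (Hc : 0 < c) by (unfold c; lra).
  assert (HG : (x - y) * ln c + ln (Gamma (y + beta)) <= ln (Gamma (x + beta))).
  { pose proof (Gamma_shift_ge (y + beta) (x - y) ltac:(lra) ltac:(lra)) as H.
    replace (y + beta + (x - y)) with (x + beta) in H by ring.
    pose proof (Gamma_pos (y + beta) ltac:(lra)).
    apply ln_le in H; [|apply Rmult_lt_0_compat; [apply exp_pos | assumption]].
    rewrite ln_mult in H by (try apply exp_pos; assumption).
    unfold Rpower in H. rewrite ln_exp in H. exact H. }
  destruct (MVT_cor2 (fun u => u * ln u - u) ln y x) as (d & E & Hd); [lra | |].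
  - intros v Hv. apply is_derive_Reals. auto_derive; [lra|]. field. lra.
  - assert (ln d <= ln x) by (apply ln_le; lra).
    assert (Hl : ln x - ln c <= x / c - 1)
      by (rewrite <- ln_div by lra; apply ln_le_sub_1, Rdiv_lt_0_compat; lra).
    assert (0 <= (x - y) * ((x / c - 1) - (ln d - ln c))) by (apply Rmult_le_pos; lra).
    replace ((x - y) * (x - c) / c) with ((x - y) * (x / c - 1)) by (field; lra).
    lra.
Qed.

Lemma log_gamma_gap_diff_nonneg (beta x y : R) :
  1 / 2 <= beta -> 0 < y < x ->
  0 <= log_gamma_gap beta x - log_gamma_gap beta y.
Proof.
  intros Hb Hxy.
  set (D := log_gamma_gap beta x - log_gamma_gap beta y).
  assert (Hn : forall n, log_gamma_gap beta (x + INR n) - log_gamma_gap beta (y + INR n) <= D).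
  { induction n as [|n IH].
    - simpl. rewrite !Rplus_0_r. unfold D. lra.
    - rewrite S_INR, <- !Rplus_assoc. pose proof (pos_INR n).
      pose proof (log_gamma_gap_diff_succ beta (x + INR n) (y + INR n)). lra. }
  destruct (Rle_or_lt 0 D) as [H|H]; [exact H|].
  exfalso.
  (* [q] bounds the numerator for every [n], since [x + INR n - c = x - y - beta + 1]. *)
  set (q := (x - y) * (x + 1)).
  (* The extra 1 offsets the [- 1] in [c], so that [c > q / - D] and the lower bound exceeds [D],
     against [Hn]. *)
  destruct (INR_unbounded (1 + q / - D)) as [n Hbig].
  assert (Hq : 0 < q) by (apply Rmult_lt_0_compat; lra).
  assert (Hqd : 0 < q / - D) by (apply Rdiv_lt_0_compat; lra).
  pose proof (log_gamma_gap_diff_ge beta (x + INR n) (y + INR n)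
                ltac:(lra) ltac:(lra) ltac:(lra)) as Hge.
  specialize (Hn n).
  set (c := y + INR n + beta - 1) in Hge.
  assert (Hc : q / - D < c) by (unfold c; lra).
  assert (Hnum : (x + INR n - (y + INR n)) * (x + INR n - c) <= q).
  { replace (x + INR n - (y + INR n)) with (x - y) by ring.
    apply Rmult_le_compat_l; unfold c; lra. }
  assert (Hqc : q < c * - D).
  { apply (Rmult_lt_compat_r (- D)) in Hc; [|lra].
    replace (q / - D * - D) with q in Hc by (field; lra). exact Hc. }
  assert (Hlt : (x + INR n - (y + INR n)) * (x + INR n - c) / c < - D).
  { apply (Rmult_lt_reg_r c); [lra|].
    unfold Rdiv at 1. rewrite Rmult_assoc, Rinv_l, Rmult_1_r by lra. lra. }
  lra.
Qed.

(** The limit argument gives only a weak inequality; applying it after one strictly decreasing step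
    recovers strictness. *)
Lemma log_gamma_gap_increasing (beta x y : R) :
  1 / 2 <= beta -> 0 < y < x -> log_gamma_gap beta y < log_gamma_gap beta x.
Proof.
  intros Hb Hxy.
  pose proof (log_gamma_gap_diff_succ beta x y Hb Hxy).
  pose proof (log_gamma_gap_diff_nonneg beta (x + 1) (y + 1) Hb).
  lra.
Qed.

Theorem theorem5 (alpha beta : R) (hab : alpha >= beta) (hb : beta >= 1 / 2)
    (x y : R) (hx : 0 < x) (hy : 0 < y) (hxy : x <> y) :
  identric_mean x y <
    Rpower (Rpower (x / y) (alpha - beta) * (Gamma (x + beta) / Gamma (y + beta)))
           (1 / (x - y)).
Proof.
  pose proof (Gamma_pos (x + beta) ltac:(lra)) as HGx.
  pose proof (Gamma_pos (y + beta) ltac:(lra)) as HGy.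
  (* In logarithms, the claim is that the slope of [U] between [x] and [y] is positive. *)
  set (U := fun u => (alpha - beta) * ln u + log_gamma_gap beta u).
  assert (HU : forall u v, 0 < v < u -> 0 < (U u - U v) / (u - v)).
  { intros u v Huv. apply Rdiv_lt_0_compat; [|lra]. unfold U.
    pose proof (log_gamma_gap_increasing beta u v ltac:(lra) Huv).
    assert (ln v < ln u) by (apply ln_increasing; lra).
    assert (0 <= (alpha - beta) * (ln u - ln v)) by (apply Rmult_le_pos; lra).
    lra. }
  assert (Hslope : 0 < (U x - U y) / (x - y)).
  { destruct (Rtotal_order x y) as [H|[H|H]]; [|contradiction|now apply HU].
    replace ((U x - U y) / (x - y)) with ((U y - U x) / (y - x)) by (field; lra).
    now apply HU. }
  unfold identric_mean, Rpower.
  unfold Rdiv at 1. rewrite Rmult_1_l, <- exp_Ropp, <- exp_plus.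
  apply exp_increasing.
  rewrite ln_mult by (try apply exp_pos; now apply Rdiv_lt_0_compat).
  rewrite !ln_div by (try apply exp_pos; assumption).
  rewrite !ln_exp.
  (* The right exponent minus the left one equals the slope of [U] exactly. *)
  apply Rlt_0_minus. eapply Rlt_le_trans; [exact Hslope|]. apply Req_le.
  unfold U, log_gamma_gap. field. lra.
Qed.
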